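(* For regular curves $C:y=y(x)$ in $A^2$, the one-form $$ds=\frac{|3y_{xx}y_{xxxx}-5y_{xxx}^2|^{1/2}}{\sqrt3\,y_{xx}}\,dx$$ is an invariant arc element for orientation-preserving affine transformations: if $g\in Aff^+(2)$ maps the regular curve $C:y=y(x)$ onto a curve $C':y'=y'(x')$, and $ds'$ denotes the one-form given by the same formula for $C'$, then $g^*ds'=ds$ on $C$. As a consequence $$\frac{d}{ds}=\frac{\sqrt3\,y_{xx}}{|3y_{xx}y_{xxxx}-5y_{xxx}^2|^{1/2}}\frac{d}{dx}$$ is an invariant differential operator, i.e. $\frac{d}{ds}(h\circ g)=\left(\frac{d}{ds'}h\right)\circ g$ for every smooth function $h$ on $C'$.
   Context: $A^2$ is the real affine plane with affine coordinates $(x,y)$; $Aff^+(2)$ is the group of maps $Z\mapsto LZ+v$ with $L\in GL_2(\mathbb R)$, $\det L>0$, $v\in\mathbb R^2$. Subscripts $x$ denote derivatives of $y(x)$. A smooth curve $y=y(x)$, $x$ in an open interval, is regular if $y_{xx}\neq0$ and $3y_{xx}y_{xxxx}-5y_{xxx}^2\neq0$ at all of its points. *)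

(* Defs.v *)
From HB Require Import structures.
From mathcomp Require Import all_boot all_order all_algebra.
From mathcomp Require Import all_classical all_reals all_analysis.

Set Implicit Arguments.
Unset Strict Implicit.
Unset Printing Implicit Defensive.

Import Order.TTheory GRing.Theory Num.Theory.
Import numFieldNormedType.Exports.

Local Open Scope ring_scope.
Local Open Scope classical_set_scope.

(* For open I, the values f^`(n) x with x \in I depend only on f over I, so
   functions on I may be represented by total functions. *)
Definition smooth_on (R : realType) (I : set R) (f : R -> R) : Prop :=
  forall (n : nat) (x : R), I x -> derivable f^`(n)%classic x 1.

Record curve (R : realType) := Curve {
  dom : set R;
  yfun : R -> R;
  dom_neq0 : dom !=set0;
  dom_open : open dom;
  dom_itv : is_interval dom;
  yfun_smooth : smooth_on dom yfun
}.

Section AffinePlane.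
Variable R : realType.
Implicit Types (C : curve R) (p v : 'cV[R]_2) (h : 'cV[R]_2 -> R).

Definition mkpt (a b : R) : 'cV[R]_2 := \col_i (if i == 0 then a else b).
Definition xcoord p : R := p 0 0.
Definition ycoord p : R := p 1 0.

Definition graph C (x : R) : 'cV[R]_2 := mkpt x (yfun C x).

Definition carrier C : set 'cV[R]_2 :=
  [set p | dom C (xcoord p) /\ ycoord p = yfun C (xcoord p)].

Definition tangent C p : set 'cV[R]_2 :=
  [set t *: mkpt 1 ((yfun C)^`()%classic (xcoord p)) | t in [set: R]].

Definition Affp : set ('cV[R]_2 -> 'cV[R]_2) :=
  [set g | exists (L : 'M[R]_2) (w : 'cV[R]_2),
     0 < \det L /\ g = (fun Z => L *m Z + w)].

Definition affdisc C (x : R) : R :=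
  3 * (yfun C)^`(2)%classic x * (yfun C)^`(4)%classic x
    - 5 * ((yfun C)^`(3)%classic x) ^+ 2.

Definition regular C : Prop :=
  forall x, dom C x -> (yfun C)^`(2)%classic x != 0 /\ affdisc C x != 0.

(* A one-form on C takes a point p of C and a vector v tangent to C at p; the
   form dx sends v to xcoord v. Its values for other p, v are meaningless. *)
Definition oneform := 'cV[R]_2 -> 'cV[R]_2 -> R.

Definition oneform_eq_on C (w1 w2 : oneform) : Prop :=
  forall p, carrier C p -> forall v, tangent C p v -> w1 p v = w2 p v.

Definition pullback (g : 'cV[R]_2 -> 'cV[R]_2) (w : oneform) : oneform :=
  fun p v => w (g p) ('d g p v).

Definition ds C : oneform := fun p v =>
  Num.sqrt `|affdisc C (xcoord p)|
    / (Num.sqrt 3 * (yfun C)^`(2)%classic (xcoord p)) * xcoord v.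

(* Functions on C are represented by total functions on the plane. Only their
   values on C matter, since they are used through h \o graph C on the open
   set dom C. *)
Definition smooth_fun C h : Prop := smooth_on (dom C) (h \o graph C).

Definition d_ds C h : 'cV[R]_2 -> R := fun p =>
  (Num.sqrt 3 * (yfun C)^`(2)%classic (xcoord p))
    / Num.sqrt `|affdisc C (xcoord p)| * (h \o graph C)^`()%classic (xcoord p).

End AffinePlane.

(* Main.v *)
Require Import Defs.
From mathcomp Require Import all_boot all_order all_algebra.
From mathcomp Require Import all_classical all_reals all_analysis.
From mathcomp Require Import ring.

Set Implicit Arguments.
Unset Strict Implicit.

Import Order.TTheory GRing.Theory Num.Theory.
Import numFieldNormedType.Exports.
Local Open Scope ring_scope.
Local Open Scope classical_set_scope.

(** Write g Z = L Z + w, and let phi x be the abscissa of the image of the point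
    (x, y x) of C. The curve C' is the graph of a smooth function Y, and the
    image of C being C' means that Y (phi x) is the ordinate of that image. The
    velocity of the image is (u, v) = L (1, y'), so that phi' = u; differentiating
    the relation gives Y' u = v (derivatives of Y are taken at phi x). Hence u
    does not vanish: otherwise (u, v) = 0, although L is invertible and
    (1, y') is not 0. So no point of C is sent to a point with vertical tangent,
    and phi is a change of parameter.

    Each further derivative of Y comes from the previous one by a single rule:
    if G (phi x) u^n = F x then G' (phi x) u^(n+2) = F' u - n F u'. It is
    [derive1_weighted], and keeping the powers of u on the left makes every
    right-hand side a polynomial. With D = det L and b = L 0 1, so that
    u' = b y2, and with indices for the orders of derivatives, one finds
      Y2 u^3 = D y2,
      Y3 u^5 = D (u y3 - 3 b y2^2),
      Y4 u^7 = D (u^2 y4 - 10 b u y2 y3 + 15 b^2 y2^3).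
    In 3 Y2 Y4 - 5 Y3^2 all terms that contain b cancel, which leaves
      (3 Y2 Y4 - 5 Y3^2) u^8 = D^2 (3 y2 y4 - 5 y3^2)
    ([affdisc_affine_image]). Thus C' is regular. Taking square roots, where
    u^4 >= 0 and D > 0, and dividing by Y2 u^3 = D y2, the factor D cancels
    and the coefficient of ds' times u is the coefficient of ds
    ([arc_coef_affine_image]). This is right whatever the sign of u is: the only
    root extracted from a power of u is that of u^8.

    Since a tangent vector t (1, y') has an image of abscissa t u, this says
    that ds' pulls back to ds. Since differentiating h o g along C multiplies
    the derivative of h along C' by u, it also says that d/ds and d/ds' agree. *)

(** * Linear maps of column vectors *)

Lemma mulmx_sum_col (R : comPzRingType) m n (A : 'M[R]_(m, n)) (v : 'cV[R]_n) :
  A *m v = \sum_j v j 0 *: col j A.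
Proof.
by apply/colP => i; rewrite !mxE summxE; apply: eq_bigr => j _; rewrite !mxE mulrC.
Qed.

Lemma det2 (R : comNzRingType) (A : 'M[R]_2) :
  \det A = A 0 0 * A 1 1 - A 0 1 * A 1 0.
Proof.
rewrite (expand_det_row _ 0) !big_ord_recl big_ord0 /cofactor !det_mx11 !mxE /=.
have -> : lift 0 0 = 1 :> 'I_2 by exact/val_inj.
have -> : lift 1 0 = 0 :> 'I_2 by exact/val_inj.
by ring.
Qed.

Lemma mulmx_colvec_continuous (R : realType) m n (A : 'M[R]_(m.+1, n.+1)) :
  continuous (mulmx A : 'cV[R]_n.+1 -> 'cV[R]_m.+1).
Proof.
rewrite (_ : mulmx A = \sum_(j < n.+1)
    (fun v : 'cV[R]_n.+1 => v j 0 *: col j A)); last first.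
  by apply/funext => v; rewrite mulmx_sum_col fct_sumE.
move=> v; apply: differentiable_continuous; apply: differentiable_sum => j.
exact/differentiableZl/differentiable_coord.
Qed.

Lemma diff_affine_map (R : realType) m n (A : 'M[R]_(m.+1, n.+1)) w
    (p v : 'cV[R]_n.+1) :
  'd (fun Z : 'cV[R]_n.+1 => A *m Z + w) p v = A *m v.
Proof.
pose f := GRing.Linear.clone _ _ _ _ (mulmx A : 'cV[R]_n.+1 -> 'cV[R]_m.+1) _.
have cf : continuous f by exact: mulmx_colvec_continuous.
rewrite (_ : (fun Z => _) = (f : 'cV[R]_n.+1 -> 'cV[R]_m.+1) + cst w) //.
have df : differentiable f p by exact: linear_differentiable.
have dw : differentiable (cst w : 'cV[R]_n.+1 -> 'cV[R]_m.+1) p.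
  exact: differentiable_cst.
rewrite [LHS](congr1 (@^~ v) (diffD df dw)) -[RHS]addr0 /=.
have diff_f := congr1 (@^~ v) (diff_lin p cf).
have diff_w := congr1 (@^~ v) (@diff_cst _ _ 'cV[R]_m.+1 w p).
by congr (_ + _).
Qed.

(** * Differentiation along a change of parameter *)

Section ChangeOfParameter.
Variables (R : realType) (I : set R) (phi : R -> R).
Hypothesis openI : open I.

(** Chain rule for a relation that holds only on the open set I. The derivative
    of F is a conclusion, so that the rule yields a derivative of h o g along C;
    when it is already known, uniqueness turns the rule into an equation for the
    derivative of G. *)
Lemma is_derive1_comp_on (G F : R -> R) (x dphi : R) :
    I x -> (forall t, I t -> G (phi t) = F t) -> derivable G (phi x) 1 ->
    is_derive x 1 phi dphi ->
  is_derive x 1 F (G^`()%classic (phi x) * dphi).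
Proof.
move=> Ix GF dG dphix.
have GFnear : \near x, (G \o phi) x = F x.
  by near=> t; apply: GF; near: t; exact: open_nbhs_nbhs.
apply: near_eq_is_derive GFnear _; apply: is_derive1_comp.
by rewrite derive1E; exact: derivableP.
Unshelve. all: by end_near. Qed.

(** The product and chain rules applied to the hypothesis on F give
    G' (phi x) u^(n+1) + n G (phi x) u^(n-1) du = dF; multiplying by u turns the
    second term into n F du, since G (phi x) u^n = F. No division occurs, so the
    conclusion has the shape of the hypothesis, with n + 2 instead of n, and
    the rule can be iterated. *)
Lemma derive1_weighted (G F u : R -> R) (n : nat) (x du dF : R) :
    I x -> (forall t, I t -> G (phi t) * u t ^+ n = F t) ->
    derivable G (phi x) 1 -> is_derive x 1 phi (u x) ->
    is_derive x 1 u du -> is_derive x 1 F dF ->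
  G^`()%classic (phi x) * u x ^+ n.+2 = dF * u x - n%:R * F x * du.
Proof.
move=> Ix GF dG dphi du_x dFx.
have := derivableP dG; rewrite -derive1E => dGx.
have GFnear : \near x, ((G \o phi) * (u ^+ n)) x = F x.
  near=> t; rewrite -GF /=; last by near: t; exact: open_nbhs_nbhs.
  by rewrite /= mulrfctE exprfctE.
have := @near_eq_derive _ R R _ _ _ (1 : R) GFnear.
rewrite !derive_val /= -GF //= => <-.
rewrite /GRing.scale /= exprfctE.
(* The rule for powers produces u ^+ n.-1, so n = 0 is apart. *)
case: n {GF GFnear} => [|n]; first by rewrite !exprS !expr0 /=; ring.
by rewrite !exprS /=; ring.
Unshelve. all: by end_near. Qed.

End ChangeOfParameter.

Lemma is_derive_line (R : realType) (f : R -> R) (a b c x df : R) :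
  is_derive x 1 f df ->
  is_derive x 1 (fun t => a * t + b * f t + c) (a + b * df).
Proof.
move=> dfx.
have -> : (fun t => a * t + b * f t + c) = a *: id + b *: f + cst c.
  by apply/funext.
have d := is_deriveD (is_deriveD (is_deriveZ a (is_derive_id x (1 : R)))
  (is_deriveZ b dfx)) (is_derive_cst c x 1).
by apply: is_derive_eq d _; rewrite addr0 [_ *: 1]mulr1.
Qed.

(** The differentiated expression has the shape that [derive3_affine_image]
    gives to the third derivative of the image. *)
Lemma is_derive_mulBsqr (R : realType) (f g h : R -> R) (k l x df dg dh : R) :
    is_derive x 1 f df -> is_derive x 1 g dg -> is_derive x 1 h dh ->
  is_derive x 1 (fun t => k * (f t * h t - l * g t ^+ 2))
    (k * (df * h x + f x * dh - 2 * l * g x * dg)).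
Proof.
move=> dfx dgx dhx.
have -> : (fun t => k * (f t * h t - l * g t ^+ 2))
    = k *: (f * h - l *: (g ^+ 2)) by apply/funext.
have d := is_deriveZ k (is_deriveB (is_deriveM dfx dhx)
  (is_deriveZ l (is_deriveX 2 dgx))).
by apply: is_derive_eq d _; rewrite /GRing.scale /=; ring.
Qed.

(** * Scaling of the arc coefficient *)

(** The power of u that leaves the square root is even, hence no absolute value
    of u appears. *)
Lemma sqrt_norm_scale (R : rcfType) (a b d u : R) :
  0 <= d -> a * u ^+ 8 = d ^+ 2 * b ->
  Num.sqrt `|a| * u ^+ 4 = d * Num.sqrt `|b|.
Proof.
move=> d0 abE; have u4 : 0 <= u ^+ 4 by rewrite (exprM u 2 2) sqr_ge0.
have norm_abE : `|a| * (u ^+ 4) ^+ 2 = d ^+ 2 * `|b|.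
  rewrite -[d ^+ 2]ger0_norm ?sqr_ge0 // -normrM -abE normrM; congr (_ * _).
  by rewrite (exprM u 4 2) ger0_norm ?sqr_ge0.
have := congr1 Num.sqrt norm_abE.
rewrite (sqrtrM _ (normr_ge0 a)) (sqrtrM _ (sqr_ge0 d)) !sqrtr_sqr.
by rewrite (ger0_norm d0) (ger0_norm u4).
Qed.

(** The discriminant has weight 8 and the second derivative weight 3 in u, so
    the quotient of the root of the one by the other has weight 4 - 3 = 1, and
    the factors d cancel. The coefficient of a one-form changes in just this way
    with the parameter. *)
Lemma arc_coef_scale (R : rcfType) (a b d u p q s : R) :
    0 < d -> u != 0 -> a * u ^+ 8 = d ^+ 2 * b -> p * u ^+ 3 = d * q ->
  Num.sqrt `|a| / (s * p) * u = Num.sqrt `|b| / (s * q).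
Proof.
move=> d0 u0 /(sqrt_norm_scale (ltW d0)) abE pqE.
have -> : p = d * q / u ^+ 3 by rewrite -pqE mulfK // expf_neq0.
have -> : Num.sqrt `|a| = d * Num.sqrt `|b| / u ^+ 4.
  by rewrite -abE mulfK // expf_neq0.
(* Keeping the inverses of s and q as atoms avoids any condition on them. *)
rewrite !invfM invrK; move: (Num.sqrt _) (s^-1) (q^-1) => B s' q'.
by field; rewrite u0 gt_eqF.
Qed.

(** * The image of a curve under an affine map *)

Lemma is_derive_yfun (R : realType) (C : curve R) (n : nat) (x : R) :
  dom C x ->
  is_derive x 1 ((yfun C)^`(n))%classic ((yfun C)^`(n.+1)%classic x).
Proof.
move=> Cx; rewrite derive1nS derive1E; apply: derivableP.
exact: yfun_smooth.
Qed.

(** The coefficient of dx in ds, whose inverse is that of d/dx in d/ds; the two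
    halves of the theorem thus rest on one transformation law. *)
Definition arc_coef (R : realType) (C : curve R) (x : R) : R :=
  Num.sqrt `|affdisc C x| / (Num.sqrt 3 * (yfun C)^`(2)%classic x).

Lemma dsE (R : realType) (C : curve R) p v :
  ds C p v = arc_coef C (xcoord p) * xcoord v.
Proof. by []. Qed.

Lemma d_dsE (R : realType) (C : curve R) h p :
  d_ds C h p = (arc_coef C (xcoord p))^-1 * (h \o graph C)^`()%classic (xcoord p).
Proof. by rewrite /arc_coef invf_div. Qed.

Lemma carrier_graph (R : realType) (C : curve R) p :
  carrier C p -> p = graph C (xcoord p).
Proof.
move=> [_ yp]; apply/colP => i; rewrite !mxE.
have [->//|i0] := eqVneq i 0.
by rewrite -yp; congr (p _ _); apply/val_inj; case: i i0 => -[|[|]].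
Qed.

Section AffineImage.
Variables (R : realType) (C C' : curve R) (L : 'M[R]_2) (w : 'cV[R]_2).
Hypothesis gC : (fun Z => L *m Z + w) @` carrier C = carrier C'.

Local Notation D := (\det L).
Local Notation y n := ((yfun C)^`(n)%classic).
Local Notation Y n := ((yfun C')^`(n)%classic).

(* The function phi is the abscissa of the image point of (x, y x), and (u, v),
   which is L (1, y'), is its velocity. *)
Let phi (x : R) : R := xcoord (L *m graph C x + w).
Let u (x : R) : R := L 0 0 + L 0 1 * y 1 x.
Let v (x : R) : R := L 1 0 + L 1 1 * y 1 x.

Lemma affine_graphE i x :
  (L *m graph C x + w) i 0 = L i 0 * x + L i 1 * yfun C x + w i 0.
Proof.
rewrite !mxE big_ord_recl big_ord1 !mxE /=.
by congr (_ + L i _ * _ + _); exact/val_inj.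
Qed.

Lemma affine_image_graph x : dom C x ->
  dom C' (phi x) /\ L *m graph C x + w = graph C' (phi x).
Proof.
move=> Cx; have : carrier C' (L *m graph C x + w).
  by rewrite -gC; exists (graph C x) => //; rewrite /carrier /= /xcoord /ycoord !mxE.
by move=> C'x; split; [case: C'x | exact: carrier_graph].
Qed.

Lemma dom_affine_image x' : dom C' x' -> exists2 x, dom C x & x' = phi x.
Proof.
move=> C'x'; have : carrier C' (graph C' x').
  by rewrite /carrier /= /xcoord /ycoord !mxE.
rewrite -gC => -[p Cp gp]; exists (xcoord p); first by case: Cp.
by rewrite /phi -carrier_graph // gp /xcoord !mxE.
Qed.

Lemma is_derive_affine_graph i x : dom C x ->
  is_derive x 1 (fun t => (L *m graph C t + w) i 0) (L i 0 + L i 1 * y 1 x).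
Proof.
move=> Cx; rewrite (funext (affine_graphE i)).
exact/is_derive_line/(is_derive_yfun 0 Cx).
Qed.

Let is_derive_slope a b x : dom C x ->
  is_derive x 1 (fun t => a + b * y 1 t) (b * y 2 x).
Proof.
move=> Cx; have := is_derive_line 0 b a (is_derive_yfun 1 Cx).
rewrite add0r (_ : (fun t => _) = (fun t => a + b * y 1 t)) //.
by apply/funext => t; rewrite mul0r add0r addrC.
Qed.

Let derivable_Y n x : dom C x -> derivable (Y n) (phi x) 1.
Proof. by move=> /affine_image_graph[C'x _]; exact: yfun_smooth. Qed.

(** The chain rule, applied to the relation that expresses that the image of C
    lies on the graph of C'. *)
Lemma speed_slope x : dom C x -> Y 1 (phi x) * u x = v x.
Proof.
move=> Cx.
have Yphi t : dom C t -> yfun C' (phi t) = (L *m graph C t + w) 1 0.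
  by move=> /affine_image_graph[_ ->]; rewrite !mxE.
have [_ <-] := is_derive1_comp_on (@dom_open R C) Cx Yphi (@derivable_Y 0 x Cx)
  (is_derive_affine_graph 0 Cx).
by have [_ ->] := is_derive_affine_graph 1 Cx.
Qed.

Let detE x : D = L 1 1 * u x - L 0 1 * v x.
Proof. by rewrite det2 /u /v; ring. Qed.

(** The vanishing of u would force that of v, hence that of D, which is a
    combination of u and v. *)
Lemma speed_neq0 x : 0 < D -> dom C x -> u x != 0.
Proof.
move=> D0 Cx; apply: contraTneq D0 => u0.
have := speed_slope Cx; rewrite u0 mulr0 => /esym v0.
by rewrite (detE x) u0 v0 !mulr0 subr0 ltxx.
Qed.

(** In the weighted rule with n = 1 and F = v, the right-hand side v' u - v u' is
    the second derivative of C times the combination of u and v that is D. *)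
Lemma derive2_affine_image x : dom C x -> Y 2 (phi x) * u x ^+ 3 = D * y 2 x.
Proof.
move=> Cx.
rewrite (derive1_weighted (n := 1) (@dom_open R C) Cx speed_slope
  (@derivable_Y 1 x Cx)
  (is_derive_affine_graph 0 Cx) (is_derive_slope _ _ Cx) (is_derive_slope _ _ Cx)).
by rewrite (detE x); ring.
Qed.

Lemma derive3_affine_image x : dom C x ->
  Y 3 (phi x) * u x ^+ 5 = D * (u x * y 3 x - 3 * L 0 1 * y 2 x ^+ 2).
Proof.
move=> Cx; have dy := is_derive_yfun 2 Cx.
have dF : is_derive x 1 (fun t => D * y 2 t) (D * y 3 x).
  by move: (y 2) (y 3 x) dy => f df dy; exact: is_deriveZ.
rewrite (derive1_weighted (@dom_open R C) Cx derive2_affine_image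
  (@derivable_Y 2 x Cx)
  (is_derive_affine_graph 0 Cx) (is_derive_slope _ _ Cx) dF).
(* Left in place, the derivatives would be compared by ring through unfolding. *)
by move: (u x) (y 2 x) (y 3 x) => *; ring.
Qed.

Lemma derive4_affine_image x : dom C x ->
  Y 4 (phi x) * u x ^+ 7 = D * (u x ^+ 2 * y 4 x
    - 10 * L 0 1 * u x * y 2 x * y 3 x + 15 * L 0 1 ^+ 2 * y 2 x ^+ 3).
Proof.
move=> Cx; have dF := is_derive_mulBsqr D (3 * L 0 1)
  (is_derive_slope (L 0 0) (L 0 1) Cx)
  (is_derive_yfun 2 Cx) (is_derive_yfun 3 Cx).
rewrite (derive1_weighted (@dom_open R C) Cx derive3_affine_image
  (@derivable_Y 3 x Cx)
  (is_derive_affine_graph 0 Cx) (is_derive_slope _ _ Cx) dF).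
by rewrite -/(u x); move: (u x) (y 2 x) (y 3 x) (y 4 x) => *; ring.
Qed.

(** The terms with L 0 1 cancel: that is what singles out the combination with
    coefficients 3 and 5. Its two products have weight 3 + 7 = 5 + 5 = 10 in u,
    and a factor u^2 on the other side brings this down to 8. *)
Lemma affdisc_affine_image x : 0 < D -> dom C x ->
  affdisc C' (phi x) * u x ^+ 8 = D ^+ 2 * affdisc C x.
Proof.
move=> D0 Cx; apply: (mulIf (expf_neq0 2 (speed_neq0 D0 Cx))).
rewrite /affdisc.
move: (derive2_affine_image Cx) (derive3_affine_image Cx) (derive4_affine_image Cx).
move: (Y 2 _) (Y 3 _) (Y 4 _) (y 2 x) (y 3 x) (y 4 x) (u x).
move=> Y2 Y3 Y4 y2 y3 y4 ux E2 E3 E4.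
transitivity (3 * (Y2 * ux ^+ 3) * (Y4 * ux ^+ 7) - 5 * (Y3 * ux ^+ 5) ^+ 2).
  by ring.
by rewrite E2 E3 E4; ring.
Qed.

Lemma arc_coef_affine_image x : 0 < D -> dom C x ->
  arc_coef C' (phi x) * u x = arc_coef C x.
Proof.
move=> D0 Cx; apply: arc_coef_scale (speed_neq0 D0 Cx) _ _; first exact: D0.
- exact: affdisc_affine_image.
- exact: derive2_affine_image.
Qed.

(** The points phi x exhaust the domain of C', so that the transformation laws
    control C' on the whole of it. *)
Lemma regular_affine_image : 0 < D -> regular C -> regular C'.
Proof.
move=> D0 regC x' /dom_affine_image[x Cx ->]; have [y2 disc] := regC x Cx.
split.
- apply: contra_neq y2 => Y2; apply: (mulfI (lt0r_neq0 D0)).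
  by rewrite -(derive2_affine_image Cx) Y2 mul0r mulr0.
- apply: contra_neq disc => disc'; apply: (mulfI (expf_neq0 2 (lt0r_neq0 D0))).
  by rewrite -(affdisc_affine_image D0 Cx) disc' mul0r mulr0.
Qed.

Lemma derive_along_affine_image h x : smooth_fun C' h -> dom C x ->
  ((h \o (fun Z => L *m Z + w)) \o graph C)^`()%classic x
  = (h \o graph C')^`()%classic (phi x) * u x.
Proof.
move=> sh Cx; have [C'x _] := affine_image_graph Cx.
have hphi t : dom C t ->
    (h \o graph C') (phi t) = ((h \o (fun Z => L *m Z + w)) \o graph C) t.
  by move=> /affine_image_graph[_ /= ->].
have [_ <-] := is_derive1_comp_on (@dom_open R C) Cx hphi (sh 0 _ C'x)
  (is_derive_affine_graph 0 Cx).
by rewrite derive1E.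
Qed.

Lemma ds_affine_image : 0 < D ->
  oneform_eq_on C (pullback (fun Z => L *m Z + w) (ds C')) (ds C).
Proof.
move=> D0 p Cp _ [t _ <-]; have [Cx _] := Cp.
rewrite /pullback diff_affine_map {1}(carrier_graph Cp).
rewrite !dsE -/(phi _).
have -> : xcoord (L *m (t *: mkpt 1 ((yfun C)^`()%classic (xcoord p))))
    = u (xcoord p) * xcoord (t *: mkpt 1 ((yfun C)^`()%classic (xcoord p))).
  rewrite -scalemxAr /xcoord !mxE /= big_ord_recl big_ord1 !mxE /= !mulr1 mulrC.
  by congr ((_ + L _ _ * _) * _); exact/val_inj.
by rewrite -(arc_coef_affine_image D0 Cx) mulrA.
Qed.

Lemma d_ds_affine_image h p : 0 < D -> smooth_fun C' h -> carrier C p ->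
  d_ds C (h \o (fun Z => L *m Z + w)) p = d_ds C' h (L *m p + w).
Proof.
move=> D0 sh Cp; have [Cx _] := Cp.
rewrite !d_dsE (derive_along_affine_image sh Cx).
rewrite [in RHS](carrier_graph Cp) -/(phi _) -(arc_coef_affine_image D0 Cx).
by rewrite invfM -mulrA; congr (_ * _); rewrite mulrC mulfK // speed_neq0.
Qed.

End AffineImage.

Theorem proposition4p1 (R : realType) (C C' : curve R)
    (g : 'cV[R]_2 -> 'cV[R]_2) (gAff : Affp g) (regC : regular C)
    (gC : g @` carrier C = carrier C') :
  [/\ regular C',
      oneform_eq_on C (pullback g (ds C')) (ds C)
    & forall h : 'cV[R]_2 -> R, smooth_fun C' h ->
        forall p : 'cV[R]_2, carrier C p ->
          d_ds C (h \o g) p = d_ds C' h (g p)].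
Proof.
case: gAff gC => L [w [D0 ->]] gC; split.
- exact: (regular_affine_image gC).
- exact: (ds_affine_image gC).
- by move=> h sh p; exact: (d_ds_affine_image gC).
Qed.
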